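(* Let $R$ be an associative ring with identity. The following assertions are equivalent: (1) Any flat left $R$-module is f-projective. (2) Any flat left $R$-module is Mittag-Leffler. (3) $\mathfrak{F}^{-1}(M)=\underline{\mathfrak{Pr}}^{-1}(M)$ for any finitely generated left $R$-module $M$. (4) The class of all modules $N$ such that $N\in\mathfrak{F}^{-1}(M)$ for every finitely generated module $M$ is precisely the class of f-projective modules.
   Context: Modules are unital left $R$-modules. A module $M$ is f-projective if for every finitely generated submodule $C$ of $M$ the inclusion map $C\to M$ factors through a finitely generated free module. A module $M$ is Mittag-Leffler (in the sense used here) if for every finitely generated submodule $C$ of $M$ the inclusion map $C\to M$ factors through a finitely presented module. A flat precover of a module $N$ is a morphism $g:F\to N$ with $F$ flat such that $\mathrm{Hom}(F',F)\to\mathrm{Hom}(F',N)$ is surjective for every flat module $F'$. The flat-precover completing domain $\mathfrak{F}^{-1}(M)$ is the class of all modules $N$ such that for every morphism $f:M\to N$ and every flat precover $g:F\to N$ there is a morphism $h:M\to F$ with $gh=f$. The subprojectivity domain $\underline{\mathfrak{Pr}}^{-1}(M)$ is the class of all modules $N$ such that for every epimorphism $g:B\to N$ and every morphism $f:M\to N$ there is a morphism $h:M\to B$ with $gh=f$. *)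

(* Defs.v *)
From HB Require Import structures.
From mathcomp Require Import all_boot all_algebra.
From mathcomp Require Import generic_quotient ring_quotient.
From mathcomp Require Import boolp.
From mathcomp Require Import freeg.

Set Implicit Arguments.
Unset Strict Implicit.
Unset Printing Implicit Defensive.

Import GRing.Theory.
Local Open Scope ring_scope.
Local Open Scope quotient_scope.

(* Left R-modules are the objects of lmodType R.  Right R-modules are the      *)
(* objects of lmodType R^c, with a.r rendered as (r : R^c) *: a.  Rings are    *)
(* pzRingType, so the zero ring is not excluded.                               *)

(* The subgroup of the free abelian group on A * M by which one divides to     *)
(* obtain the tensor product of the right module A and the left module M.      *)
Inductive tensor_rel (R : pzRingType) (A : lmodType R^c) (M : lmodType R) :
    {freeg (A * M)%type} -> Prop :=
  | TensorRel0 : tensor_rel 0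
  | TensorRelB u v : tensor_rel u -> tensor_rel v -> tensor_rel (u - v)
  | TensorRelDl a b x :
      tensor_rel (<< (a + b, x) >> - << (a, x) >> - << (b, x) >>)
  | TensorRelDr a x y :
      tensor_rel (<< (a, x + y) >> - << (a, x) >> - << (a, y) >>)
  | TensorRelZ a (r : R) x :
      tensor_rel (<< ((r : R^c) *: a, x) >> - << (a, r *: x) >>).

Definition tensor_relb (R : pzRingType) (A : lmodType R^c) (M : lmodType R) :
    {pred {freeg (A * M)%type}} := fun u => `[< tensor_rel u >].

Lemma tensor_rel_zmod_closed (R : pzRingType) (A : lmodType R^c)
  (M : lmodType R) : zmod_closed (@tensor_relb R A M).
Proof.
split=> [|u v /asboolP uR /asboolP vR]; apply/asboolP.
  exact: TensorRel0.
exact: TensorRelB.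
Qed.

HB.instance Definition _ (R : pzRingType) (A : lmodType R^c) (M : lmodType R) :=
  GRing.isZmodClosed.Build {freeg (A * M)%type} (@tensor_relb R A M)
    (@tensor_rel_zmod_closed R A M).

Definition tensor (R : pzRingType) (A : lmodType R^c) (M : lmodType R) :
  zmodType := Quotient.quot (@tensor_relb R A M).

Definition to_tensor (R : pzRingType) (A : lmodType R^c) (M : lmodType R)
  (u : {freeg (A * M)%type}) : tensor A M :=
  \pi_(Quotient.quot (@tensor_relb R A M)) u.

Definition tens (R : pzRingType) (A : lmodType R^c) (M : lmodType R)
  (a : A) (x : M) : tensor A M := to_tensor << (a, x) >>.

Definition fgmap_tensor (R : pzRingType) (A B : lmodType R^c) (M : lmodType R)
  (f : A -> B) (u : {freeg (A * M)%type}) : {freeg (B * M)%type} :=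
  fglift (fun ax => << (f ax.1, ax.2) >>) u.

(* The map f (x) id_M.  It is computed on a representative;                    *)
(* tensor_map_to_tensor shows that the choice does not matter.                 *)
Definition tensor_map (R : pzRingType) (A B : lmodType R^c) (M : lmodType R)
  (f : {linear A -> B}) (t : tensor A M) : tensor B M :=
  to_tensor (fgmap_tensor f (repr t)).

Lemma to_tensor_eq (R : pzRingType) (A : lmodType R^c) (M : lmodType R)
  (u v : {freeg (A * M)%type}) :
  to_tensor u = to_tensor v <-> tensor_rel (u - v).
Proof.
rewrite /to_tensor; split=> [/eqP|/asboolP H].
  by rewrite -Quotient.idealrBE => /asboolP.
by apply/eqP; rewrite -Quotient.idealrBE.
Qed.

Lemma to_tensorB (R : pzRingType) (A : lmodType R^c) (M : lmodType R) :
  {morph @to_tensor R A M : u v / u - v}.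
Proof. by move=> u v; rewrite /to_tensor !piE. Qed.

Lemma fgmap_tensorB (R : pzRingType) (A B : lmodType R^c) (M : lmodType R)
  (f : A -> B) : {morph @fgmap_tensor R A B M f : u v / u - v}.
Proof. exact: lift_is_additive. Qed.

Lemma fgmap_tensorU (R : pzRingType) (A B : lmodType R^c) (M : lmodType R)
  (f : A -> B) (a : A) (x : M) :
  fgmap_tensor f << (a, x) >> = << (f a, x) >>.
Proof. by rewrite /fgmap_tensor liftU scale1r. Qed.

Lemma tensor_map_to_tensor (R : pzRingType) (A B : lmodType R^c)
  (M : lmodType R) (f : {linear A -> B}) (u : {freeg (A * M)%type}) :
  tensor_map f (to_tensor u) = to_tensor (fgmap_tensor f u).
Proof.
rewrite /tensor_map; apply/to_tensor_eq; rewrite -fgmap_tensorB.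
have: tensor_rel (repr (to_tensor u) - u).
  by apply/to_tensor_eq; rewrite /to_tensor reprK.
elim=> [|v w _ vR _ wR|a b x|a x y|a r x].
- by rewrite -[0](subrr 0) fgmap_tensorB subrr; apply: TensorRel0.
- by rewrite fgmap_tensorB; apply: TensorRelB.
- by rewrite !fgmap_tensorB !fgmap_tensorU linearD; apply: TensorRelDl.
- by rewrite !fgmap_tensorB !fgmap_tensorU; apply: TensorRelDr.
- by rewrite !fgmap_tensorB !fgmap_tensorU linearZ; apply: TensorRelZ.
Qed.

Lemma tensor_map_tens (R : pzRingType) (A B : lmodType R^c) (M : lmodType R)
  (f : {linear A -> B}) (a : A) (x : M) :
  tensor_map f (tens a x) = tens (f a) x.
Proof. by rewrite tensor_map_to_tensor fgmap_tensorU. Qed.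

Lemma tensor_mapB (R : pzRingType) (A B : lmodType R^c) (M : lmodType R)
  (f : {linear A -> B}) : {morph @tensor_map R A B M f : s t / s - t}.
Proof.
move=> s t.
have E w : w = @to_tensor R A M (repr w) by rewrite /to_tensor reprK.
rewrite (E s) (E t).
by rewrite -to_tensorB !tensor_map_to_tensor fgmap_tensorB to_tensorB.
Qed.

Definition flat (R : pzRingType) (M : lmodType R) : Prop :=
  forall (A B : lmodType R^c) (f : {linear A -> B}),
    injective f -> injective (@tensor_map R A B M f).

Definition epi (R : pzRingType) (B N : lmodType R) (g : {linear B -> N}) : Prop :=
  forall y, exists x, g x = y.

Definition finitely_generated (R : pzRingType) (M : lmodType R) : Prop :=
  exists (n : nat) (e : 'I_n -> M),
    forall x, exists c : 'I_n -> R, x = \sum_(i < n) c i *: e i.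

Definition fg_free (R : pzRingType) (M : lmodType R) : Prop :=
  exists (n : nat) (f : {linear 'rV[R]_n -> M}), bijective f.

(* There is an exact sequence R^m -> R^n -> M -> 0.                            *)
Definition finitely_presented (R : pzRingType) (M : lmodType R) : Prop :=
  exists (m n : nat) (q : {linear 'rV[R]_m -> 'rV[R]_n})
         (p : {linear 'rV[R]_n -> M}),
    epi p /\ forall v, p v = 0 <-> exists w, q w = v.

Definition factors_through (R : pzRingType) (C M P : lmodType R)
  (f : {linear C -> M}) : Prop :=
  exists (u : {linear C -> P}) (v : {linear P -> M}), forall x, v (u x) = f x.

(* A submodule of M is a boolean predicate S on M together with a              *)
(* subLmodType structure C on it; the inclusion map is \val : C -> M.          *)
Definition f_projective (R : pzRingType) (M : lmodType R) : Prop :=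
  forall (S : pred M) (C : subLmodType S), finitely_generated C ->
    exists P : lmodType R, fg_free P /\ factors_through P (\val : {linear C -> M}).

Definition mittag_leffler (R : pzRingType) (M : lmodType R) : Prop :=
  forall (S : pred M) (C : subLmodType S), finitely_generated C ->
    exists P : lmodType R,
      finitely_presented P /\ factors_through P (\val : {linear C -> M}).

Definition flat_precover (R : pzRingType) (F N : lmodType R)
  (g : {linear F -> N}) : Prop :=
  flat F /\
  forall F' : lmodType R, flat F' -> forall f : {linear F' -> N},
    exists h : {linear F' -> F}, forall x, g (h x) = f x.

(* N belongs to the flat-precover completing domain of M.                      *)
Definition flat_precover_completing_domain (R : pzRingType)
  (M N : lmodType R) : Prop :=
  forall (f : {linear M -> N}) (F : lmodType R) (g : {linear F -> N}),
    flat_precover g -> exists h : {linear M -> F}, forall x, g (h x) = f x.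

(* N belongs to the subprojectivity domain of M.                               *)
Definition subprojectivity_domain (R : pzRingType) (M N : lmodType R) : Prop :=
  forall (B : lmodType R) (g : {linear B -> N}) (f : {linear M -> N}),
    epi g -> exists h : {linear M -> B}, forall x, g (h x) = f x.

(* Main.v *)
From HB Require Import structures.
From mathcomp Require Import all_boot all_algebra.
From mathcomp Require Import generic_quotient ring_quotient.
From mathcomp Require Import boolp classical_sets functions freeg.
Require Import Defs.

(* A module is flat if and only if every relation A x = 0 between its         *)
(* elements is trivial, that is, x = D y with A D = 0.  Hence every map from  *)
(* a finitely presented module to a flat module factors through some R^k, and *)
(* flat Mittag-Leffler modules are f-projective.  A module N is f-projective  *)
(* if and only if it lies in the subprojectivity domain of every finitely     *)
(* generated module, so (3) implies (4); and a flat precover of a flat module *)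
(* splits, so (4) implies (1).                                                *)
(*                                                                            *)
(* That (2) implies (3) rests on the existence of flat precovers of N.  Given *)
(* f : F -> N with F flat, let K be maximal among the pure submodules of F    *)
(* contained in ker f, so that Q = F / K is flat and the kernel of the        *)
(* induced map g : Q -> N contains no nonzero pure submodule.  Form terms by  *)
(* closing one variable under linear combinations and chosen solutions of     *)
(* linear systems, each term t being evaluated as a map Q -> Q.  For fixed x  *)
(* and y the differences t x - t y form a pure submodule containing x - y, so *)
(* that x = y as soon as g (t x) = g (t y) for all t.  Thus Q embeds into the *)
(* set of functions from terms to N, which does not depend on F, and the      *)
(* direct sum of all flat quotients of the free module on that set, with all  *)
(* their maps to N, is a flat precover.                                       *)

Set Implicit Arguments.
Unset Strict Implicit.
Unset Printing Implicit Defensive.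

Import GRing.Theory.
Local Open Scope ring_scope.
Local Open Scope quotient_scope.

(** * Linear maps *)

Section LinearMaps.
Variable R : pzRingType.
Implicit Types U V W : lmodType R.

Definition linear_pack U V (f : U -> V) (f_lin : linear f) : {linear U -> V} :=
  HB.pack f (GRing.isLinear.Build R U V _ f f_lin).

Lemma epi_factor U V W (p : {linear U -> V}) (f : {linear U -> W}) :
  epi p -> (forall x, p x = 0 -> f x = 0) ->
  exists g : {linear V -> W}, forall x, g (p x) = f x.
Proof.
move=> /choice[s sK] ker_sub.
have fsp x : f (s (p x)) = f x.
  by apply/eqP; rewrite -subr_eq0 -linearB ker_sub // linearB sK subrr.
have g_lin : linear (f \o s).
  by move=> a x y; rewrite -[x in LHS]sK -[y in LHS]sK -linearP /= fsp linearP.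
by exists (linear_pack g_lin).
Qed.

Lemma bij_linear_inverse U V (f : {linear U -> V}) :
  bijective f -> exists g : {linear V -> U}, cancel f g /\ cancel g f.
Proof.
move=> [h fK hK].
have [y|x fx0|g gf] := @epi_factor _ _ _ f idfun; first by exists (h y).
  by apply: (can_inj fK); rewrite fx0 linear0.
by exists g; split=> // y; rewrite -[y]hK gf.
Qed.

Lemma scaler_linear V (x : V) : linear (fun a : R^o => (a : R) *: x).
Proof. by move=> a b c; rewrite scalerDl scalerA. Qed.

Definition scaler_to V (x : V) : {linear R^o -> V} :=
  linear_pack (scaler_linear x).

End LinearMaps.

(** * Submodules and quotients *)

Record submodule (R : pzRingType) (V : lmodType R) := Submodule {
  submod_pred :> {pred V};
  submod_predP : submod_closed submod_pred
}.

HB.instance Definition _ (R : pzRingType) (V : lmodType R) (K : submodule V) :=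
  GRing.isSubmodClosed.Build R V (submod_pred K) (submod_predP K).

Section SubmoduleTypes.
Variables (R : pzRingType) (V : lmodType R) (K : submodule V).

Definition submod_type : Type := {x | x \in K}.

HB.instance Definition _ := SubType.on submod_type.
HB.instance Definition _ := [Choice of submod_type by <:].
HB.instance Definition _ := [SubChoice_isSubLmodule of submod_type by <:].

Definition quotmod : Type := Quotient.quot K.

HB.instance Definition _ := GRing.Zmodule.on quotmod.

Definition to_quot (x : V) : quotmod := \pi_quotmod x.

Lemma to_quotK u : to_quot (repr u) = u.
Proof. exact: reprK. Qed.

Lemma to_quotE x y : (to_quot x == to_quot y) = (x - y \in K).
Proof. by rewrite Quotient.idealrBE. Qed.

Lemma to_quotD : {morph to_quot : x y / x + y}.
Proof. by move=> x y; rewrite /to_quot !piE. Qed.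

Definition quot_scale (a : R) (u : quotmod) : quotmod := to_quot (a *: repr u).

Lemma quot_scaleE a x : quot_scale a (to_quot x) = to_quot (a *: x).
Proof.
by apply/eqP; rewrite to_quotE -scalerBr rpredZ // -to_quotE to_quotK.
Qed.

Lemma quot_scaleA a b u : quot_scale a (quot_scale b u) = quot_scale (a * b) u.
Proof. by rewrite -[u]to_quotK !quot_scaleE scalerA. Qed.

Lemma quot_scale1 : left_id 1 quot_scale.
Proof. by move=> u; rewrite -[u]to_quotK quot_scaleE scale1r. Qed.

Lemma quot_scaleDr : right_distributive quot_scale +%R.
Proof.
move=> a u v; rewrite -[u]to_quotK -[v]to_quotK -to_quotD !quot_scaleE.
by rewrite scalerDr to_quotD.
Qed.

Lemma quot_scaleDl u : {morph quot_scale^~ u : a b / a + b}.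
Proof. by move=> a b; rewrite -[u]to_quotK !quot_scaleE scalerDl to_quotD. Qed.

HB.instance Definition _ := GRing.Zmodule_isLmodule.Build R quotmod
  quot_scaleA quot_scale1 quot_scaleDr quot_scaleDl.

Lemma to_quot_linear : linear to_quot.
Proof. by move=> a x y; rewrite to_quotD -quot_scaleE. Qed.

HB.instance Definition _ :=
  GRing.isLinear.Build R V quotmod _ to_quot to_quot_linear.

Lemma to_quot_eq0 x : (to_quot x == 0) = (x \in K).
Proof. by rewrite -(linear0 to_quot) to_quotE subr0. Qed.

Lemma to_quot_epi : epi to_quot.
Proof. by move=> u; exists (repr u); apply: to_quotK. Qed.

Lemma to_quot_lift (T : Type) (u : T -> quotmod) : exists x, u = to_quot \o x.
Proof. by exists (repr \o u); apply/funext => t /=; rewrite to_quotK. Qed.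

End SubmoduleTypes.

Section Preimage.
Variables (R : pzRingType) (V W : lmodType R) (f : {linear V -> W}).

Lemma preim_submod_closed (K : submodule W) : submod_closed [preim f of K].
Proof.
split=> [|a x y]; first by rewrite inE linear0 rpred0.
by rewrite !inE linearP => Kx Ky; rewrite rpredD // rpredZ.
Qed.

Definition preim_submod (K : submodule W) : submodule V :=
  Submodule (preim_submod_closed K).

Lemma in_preim_submod K x : (x \in preim_submod K) = (f x \in K).
Proof. by []. Qed.

Lemma zero_submod_closed : submod_closed (pred1 (0 : W)).
Proof.
by split=> [|a x y /eqP -> /eqP ->]; rewrite inE ?scaler0 ?addr0.
Qed.

Definition zero_submod : submodule W := Submodule zero_submod_closed.

Lemma in_zero_submod y : (y \in zero_submod) = (y == 0).
Proof. by []. Qed.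

Definition ker_submod : submodule V := preim_submod zero_submod.

Lemma in_ker_submod x : (x \in ker_submod) = (f x == 0).
Proof. by []. Qed.

Lemma quotmod_ker_embedding : exists g : {linear quotmod ker_submod -> W},
  injective g /\ forall x, g (to_quot ker_submod x) = f x.
Proof.
have [x /eqP|g gE] := @epi_factor _ _ _ _ _ f (@to_quot_epi _ _ ker_submod).
  by rewrite to_quot_eq0 in_ker_submod => /eqP.
exists g; split=> // u v; rewrite -[u]to_quotK -[v]to_quotK !gE => fuv.
by apply/eqP; rewrite to_quotE in_ker_submod linearB fuv subrr.
Qed.

Lemma quotmod_ker_iso : epi f -> exists g : {linear quotmod ker_submod -> W},
  bijective g /\ forall x, g (to_quot ker_submod x) = f x.
Proof.
move=> /choice[s sK]; have [g [g_inj gE]] := quotmod_ker_embedding.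
exists g; split=> //; exists (to_quot ker_submod \o s) => [u|y] /=.
  by apply: g_inj; rewrite gE sK.
by rewrite gE sK.
Qed.

End Preimage.

Section Image.
Variables (R : pzRingType) (V W : lmodType R) (f : {linear V -> W}).

Definition image_pred : {pred W} := fun y => `[< exists x, f x = y >].

Lemma image_submod_closed : submod_closed image_pred.
Proof.
split=> [|a _ _ /asboolP[x <-] /asboolP[y <-]]; apply/asboolP.
  by exists 0; rewrite linear0.
by exists (a *: x + y); rewrite linearP.
Qed.

Definition image_submod : submodule W := Submodule image_submod_closed.

Lemma image_submodP x : f x \in image_submod.
Proof. by apply/asboolP; exists x. Qed.

Definition to_image (x : V) : submod_type image_submod :=
  Sub (f x) (image_submodP x).

Lemma to_image_linear : linear to_image.
Proof. by move=> a x y; apply: val_inj; rewrite /= linearP. Qed.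

HB.instance Definition _ :=
  GRing.isLinear.Build R V (submod_type image_submod) _ to_image
    to_image_linear.

Lemma to_image_epi : epi to_image.
Proof.
by move=> u; have /asboolP[x fx] := valP u; exists x; apply: val_inj.
Qed.

End Image.

(** * Direct sums and free modules *)

(* The library equips only non-dependent function spaces with pointwise       *)
(* operations.                                                                *)
Definition dprod (R : pzRingType) (I : Type) (M : I -> lmodType R) : Type :=
  forall i, M i.

Section DirectProduct.
Variables (R : pzRingType) (I : Type) (M : I -> lmodType R).
Local Notation T := (dprod M).
Implicit Types u v w : T.

HB.instance Definition _ := Choice.copy T (forall i, M i : choiceType).

Lemma dprod_eq u v : (forall i, u i = v i) -> u = v.
Proof. exact: functional_extensionality_dep. Qed.

Definition dprod_add u v : T := fun i => u i + v i.
Definition dprod_opp u : T := fun i => - u i.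
Definition dprod_scale (a : R) u : T := fun i => a *: u i.

Lemma dprod_addA : associative dprod_add.
Proof. by move=> u v w; apply: dprod_eq => i; apply: addrA. Qed.

Lemma dprod_addC : commutative dprod_add.
Proof. by move=> u v; apply: dprod_eq => i; apply: addrC. Qed.

Lemma dprod_add0 : left_id (fun=> 0) dprod_add.
Proof. by move=> u; apply: dprod_eq => i; apply: add0r. Qed.

Lemma dprod_addN : left_inverse (fun=> 0) dprod_opp dprod_add.
Proof. by move=> u; apply: dprod_eq => i; apply: addNr. Qed.

HB.instance Definition _ :=
  GRing.isZmodule.Build T dprod_addA dprod_addC dprod_add0 dprod_addN.

Lemma dprod_scaleA a b u :
  dprod_scale a (dprod_scale b u) = dprod_scale (a * b) u.
Proof. by apply: dprod_eq => i; apply: scalerA. Qed.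

Lemma dprod_scale1 : left_id 1 dprod_scale.
Proof. by move=> u; apply: dprod_eq => i; apply: scale1r. Qed.

Lemma dprod_scaleDr : right_distributive dprod_scale +%R.
Proof. by move=> a u v; apply: dprod_eq => i; apply: scalerDr. Qed.

Lemma dprod_scaleDl u : {morph dprod_scale^~ u : a b / a + b}.
Proof. by move=> a b; apply: dprod_eq => i; apply: scalerDl. Qed.

HB.instance Definition _ := GRing.Zmodule_isLmodule.Build R T
  dprod_scaleA dprod_scale1 dprod_scaleDr dprod_scaleDl.

End DirectProduct.

Section DirectSum.
Variables (R : pzRingType) (I : choiceType) (M : I -> lmodType R).

Definition finitely_supported : {pred dprod M} :=
  fun w => `[< exists s : seq I, forall i, i \notin s -> w i = 0 >].

Lemma finitely_supported_closed : submod_closed finitely_supported.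
Proof.
split=> [|a u v /asboolP[s us] /asboolP[t vt]]; apply/asboolP.
  by exists [::].
exists (s ++ t) => i; rewrite mem_cat => /norP[/us ui /vt vi].
have -> : (a *: u + v) i = a *: u i + v i by [].
by rewrite ui vi scaler0 addr0.
Qed.

Definition dsum : lmodType R :=
  submod_type (Submodule finitely_supported_closed).

Definition component (i : I) (w : dsum) : M i := val w i.

Lemma component_linear i : linear (component i).
Proof. by move=> a v w; rewrite /component linearP. Qed.

HB.instance Definition _ i :=
  GRing.isLinear.Build R dsum (M i) _ (component i) (component_linear i).

Lemma dsum_eq v w : (forall i, component i v = component i w) -> v = w.
Proof. by move=> vw; apply/val_inj/dprod_eq. Qed.

Lemma supp_subproof (w : dsum) :
  exists s : seq I, uniq s /\ forall i, i \notin s -> component i w = 0.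
Proof.
have /asboolP[s ws] := valP w.
by exists (undup s); rewrite undup_uniq; split=> // i; rewrite mem_undup => /ws.
Qed.

Definition supp (w : dsum) : seq I := sval (cid (supp_subproof w)).

Lemma supp_uniq w : uniq (supp w).
Proof. by have [] := svalP (cid (supp_subproof w)). Qed.

Lemma component_supp w i : i \notin supp w -> component i w = 0.
Proof. by have [_ /[apply]] := svalP (cid (supp_subproof w)). Qed.

Definition common_supp (r : seq dsum) : seq I :=
  undup (flatten [seq supp w | w <- r]).

Lemma common_supp_uniq r : uniq (common_supp r).
Proof. exact: undup_uniq. Qed.

Lemma component_common_supp r w i :
  w \in r -> i \notin common_supp r -> component i w = 0.
Proof.
move=> wr; rewrite mem_undup => ir; apply: component_supp.
by apply: contra ir => iw; apply/flatten_mapP; exists w.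
Qed.

Lemma inject_subproof i (u : M i) :
  dfwith (0 : dprod M) u \in Submodule finitely_supported_closed.
Proof.
by apply/asboolP; exists [:: i] => j; rewrite inE eq_sym; apply: dfwith_out.
Qed.

Definition inject i (u : M i) : dsum :=
  Sub (dfwith (0 : dprod M) u) (inject_subproof u).

Lemma component_inject i u : component i (inject u) = u.
Proof. exact: dfwith_in. Qed.

Lemma component_inject_neq i j (u : M i) :
  i != j -> component j (inject u) = 0.
Proof. exact: dfwith_out. Qed.

Lemma inject_linear i : linear (@inject i).
Proof.
move=> a u v; apply: dsum_eq => j; rewrite linearP /=.
have [<-|ij] := eqVneq i j; first by rewrite !component_inject.
by rewrite !component_inject_neq // scaler0 addr0.
Qed.

HB.instance Definition _ i :=
  GRing.isLinear.Build R (M i) dsum _ (@inject i) (@inject_linear i).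

Lemma dsum_decomp (w : dsum) (s : seq I) :
  uniq s -> (forall i, i \notin s -> component i w = 0) ->
  w = \sum_(i <- s) inject (component i w).
Proof.
move=> s_uniq ws; apply: dsum_eq => j; rewrite linear_sum /=.
have [js|/[dup] js /ws ->] := boolP (j \in s).
  rewrite (bigD1_seq j) //= component_inject big1 ?addr0 // => i.
  exact: component_inject_neq.
rewrite big1_seq // => i /andP[_ si]; apply: component_inject_neq.
by apply: contraNneq js => <-.
Qed.

Section Extension.
Variables (N : lmodType R) (g : forall i, {linear M i -> N}).

Definition dsum_ext (w : dsum) : N := \sum_(i <- supp w) g i (component i w).

Lemma dsum_extE (w : dsum) (s : seq I) :
  uniq s -> (forall i, i \notin s -> component i w = 0) ->
  dsum_ext w = \sum_(i <- s) g i (component i w).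
Proof.
move=> s_uniq ws; rewrite /dsum_ext.
rewrite [LHS](bigID (fun i => component i w == 0)).
rewrite [RHS](bigID (fun i => component i w == 0)) /=.
rewrite ![X in X + _ = _]big1 ?[X in _ = X + _]big1 ?add0r //;
  try by move=> i /eqP ->; rewrite linear0.
rewrite -[LHS]big_filter -[RHS]big_filter; apply: perm_big; apply: uniq_perm.
- exact/filter_uniq/supp_uniq.
- exact: filter_uniq.
move=> i; rewrite !mem_filter; apply: andb_id2l => wi.
apply/idP/idP => _; apply: contraNT wi; first by move/ws ->.
by move/component_supp ->.
Qed.

Lemma dsum_ext_linear : linear dsum_ext.
Proof.
move=> a v w; pose s := common_supp [:: v; w].
have s_uniq : uniq s := common_supp_uniq _.
have vs i : i \notin s -> component i v = 0.
  by apply: component_common_supp; rewrite mem_head.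
have ws i : i \notin s -> component i w = 0.
  by apply: component_common_supp; rewrite !inE eqxx orbT.
rewrite (dsum_extE s_uniq vs) (dsum_extE s_uniq ws) (@dsum_extE _ s) //.
  by rewrite scaler_sumr -big_split; apply: eq_bigr => i _ /=; rewrite !linearP.
by move=> i si; rewrite linearP /= vs // ws // scaler0 addr0.
Qed.

HB.instance Definition _ :=
  GRing.isLinear.Build R dsum N _ dsum_ext dsum_ext_linear.

Lemma dsum_ext_inject i (u : M i) : dsum_ext (inject u) = g i u.
Proof.
rewrite (@dsum_extE _ [:: i]) // ?big_seq1 ?component_inject // => j.
by rewrite inE eq_sym; apply: component_inject_neq.
Qed.

End Extension.
End DirectSum.

Section FreeModule.
Variables (R : pzRingType) (X : choiceType).

Definition freemod : lmodType R := dsum (fun _ : X => R^o).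

Definition coef (x : X) : {linear freemod -> R^o} := component x.

Definition free_gen (x : X) : freemod := @inject R X (fun=> R^o) x 1.

Variables (M : lmodType R) (g : X -> M).

Definition free_ext : {linear freemod -> M} :=
  dsum_ext (fun x => scaler_to (g x)).

Lemma free_ext_gen x : free_ext (free_gen x) = g x.
Proof. by rewrite /free_ext /= dsum_ext_inject /= scale1r. Qed.

Lemma free_extE (w : freemod) (s : seq X) :
  uniq s -> (forall x, x \notin s -> coef x w = 0) ->
  free_ext w = \sum_(x <- s) (coef x w : R) *: g x.
Proof. exact: dsum_extE. Qed.

End FreeModule.

Arguments coef {R X} x.
Arguments free_gen {R X} x.

(** * Relations and the equational criterion *)

Section LinearCombinations.
Variables (R : pzRingType) (V : lmodType R).

Definition lincomb m n (A : 'M[R]_(m, n)) (x : 'I_n -> V) : 'I_m -> V :=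
  fun i => \sum_(j < n) A i j *: x j.

Lemma lincombB m n (A : 'M[R]_(m, n)) : {morph lincomb A : x y / x - y}.
Proof.
move=> x y; apply/funext => i; rewrite /lincomb !fctE /= -sumrB.
by apply: eq_bigr => j _; apply: scalerBr.
Qed.

HB.instance Definition _ m n (A : 'M[R]_(m, n)) :=
  GRing.isZmodMorphism.Build ('I_n -> V) ('I_m -> V) (lincomb A) (lincombB A).

Lemma lincomb_linearl m n (x : 'I_n -> V) :
  linear ((@lincomb m n)^~ x : 'M[R]_(m, n) -> 'I_m -> V).
Proof.
move=> a A B; apply/funext => i.
rewrite /lincomb !fctE /= scaler_sumr -big_split.
by apply: eq_bigr => j _ /=; rewrite !mxE scalerDl scalerA.
Qed.

Lemma lincombM m n k (A : 'M[R]_(m, n)) (B : 'M[R]_(n, k)) (y : 'I_k -> V) :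
  lincomb (A *m B) y = lincomb A (lincomb B y).
Proof.
apply/funext => i; under [LHS]eq_bigr => l _ do rewrite mxE scaler_suml.
rewrite exchange_big; apply: eq_bigr => j _ /=; rewrite scaler_sumr.
by apply: eq_bigr => l _; rewrite scalerA.
Qed.

Lemma lincomb_row_mx m n1 n2 (A1 : 'M[R]_(m, n1)) (A2 : 'M[R]_(m, n2))
    (x1 : 'I_n1 -> V) (x2 : 'I_n2 -> V) :
  lincomb (row_mx A1 A2) (row_mx (\row_j x1 j) (\row_j x2 j) 0) =
    lincomb A1 x1 + lincomb A2 x2.
Proof.
apply/funext => i; rewrite /lincomb big_split_ord !fctE; congr (_ + _).
  by apply: eq_bigr => j _; rewrite !row_mxEl mxE.
by apply: eq_bigr => j _; rewrite !row_mxEr mxE.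
Qed.

End LinearCombinations.

Lemma linear_lincomb (R : pzRingType) (V W : lmodType R) (f : {linear V -> W})
    m n (A : 'M[R]_(m, n)) (x : 'I_n -> V) i :
  f (lincomb A x i) = lincomb A (f \o x) i.
Proof. by rewrite linear_sum; apply: eq_bigr => j _; rewrite linearZ. Qed.

(* The image of ker A (x) V in V^n. *)
Definition trivial_relation (R : pzRingType) (V : lmodType R) m n
    (A : 'M[R]_(m, n)) : {pred 'I_n -> V} :=
  fun x => `[< exists k (D : 'M[R]_(n, k)) (y : 'I_k -> V),
                 A *m D = 0 /\ x = lincomb D y >].

Section TrivialRelations.
Variables (R : pzRingType) (V : lmodType R) (m n : nat) (A : 'M[R]_(m, n)).

Lemma trivial_relation_zmod_closed : zmod_closed (@trivial_relation R V m n A).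
Proof.
split=> [|_ _ /asboolP[k [D [y [AD ->]]]] /asboolP[k' [D' [y' [AD' ->]]]]];
  apply/asboolP.
  exists 0%N, 0, (fun=> 0); rewrite mulmx0; split=> //.
  by apply/funext => j; rewrite /lincomb big_ord0.
exists (k + k')%N, (row_mx D D'), (row_mx (\row_j y j) (\row_j - y' j) 0).
by rewrite mul_mx_row AD AD' row_mx0 lincomb_row_mx (raddfN (lincomb D')).
Qed.

HB.instance Definition _ :=
  GRing.isZmodClosed.Build ('I_n -> V) (@trivial_relation R V m n A)
    trivial_relation_zmod_closed.

Lemma trivial_relation_linear (W : lmodType R) (f : {linear W -> V}) x :
  x \in trivial_relation A -> f \o x \in trivial_relation A.
Proof.
move=> /asboolP[k [D [y [AD ->]]]]; apply/asboolP.
exists k, D, (f \o y); split=> //; apply/funext => j; exact: linear_lincomb.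
Qed.

Lemma trivial_relation_col (d : 'cV[R]_n) (y : V) :
  A *m d = 0 -> (fun j => d j 0 *: y) \in trivial_relation A.
Proof.
move=> Ad; apply/asboolP; exists 1%N, d, (fun=> y); split=> //.
by apply/funext => j; rewrite /lincomb big_ord1.
Qed.

End TrivialRelations.

Section EquationallyFlat.
Variable R : pzRingType.
Implicit Types M N : lmodType R.

Definition equationally_flat M : Prop :=
  forall m n (A : 'M[R]_(m, n)) (x : 'I_n -> M),
    lincomb A x = 0 -> x \in trivial_relation A.

Lemma equationally_flat_regular : equationally_flat R^o.
Proof.
move=> m n A x Ax; have -> : x = fun j => (\col_j x j) j 0 *: (1 : R^o).
  by apply/funext => j; rewrite mxE [RHS]mulr1.
apply: trivial_relation_col; apply/matrixP=> i j; rewrite !mxE.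
by rewrite -[RHS]/((0 : 'I_m -> R^o) i) -Ax; apply: eq_bigr => k _; rewrite mxE.
Qed.

Lemma equationally_flat_retract M N
    (s : {linear M -> N}) (r : {linear N -> M}) :
  cancel s r -> equationally_flat N -> equationally_flat M.
Proof.
move=> sK flatN m n A x Ax.
have -> : x = r \o (s \o x) by apply/funext => j /=; rewrite sK.
apply/trivial_relation_linear/flatN/funext => i.
by rewrite -linear_lincomb Ax linear0.
Qed.

Lemma equationally_flat_dsum (I : choiceType) (M : I -> lmodType R) :
  (forall i, equationally_flat (M i)) -> equationally_flat (dsum M).
Proof.
move=> flatM m n A x Ax.
have -> : x = \sum_(i <- common_supp (codom x))
                (@inject R I M i \o (component i \o x)).
  rewrite fct_sumE; apply/funext => j.
  apply: dsum_decomp => [|i]; first exact: common_supp_uniq.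
  exact/component_common_supp/codom_f.
apply: rpred_sum => i _; apply/trivial_relation_linear/flatM/funext => j.
by rewrite -linear_lincomb Ax linear0.
Qed.

End EquationallyFlat.

Definition pure (R : pzRingType) (F : lmodType R) (K : submodule F) : Prop :=
  forall m n (A : 'M[R]_(m, n)) (x : 'I_n -> F),
    (forall i, lincomb A x i \in K) ->
    exists k : 'I_n -> F, (forall j, k j \in K) /\ lincomb A k = lincomb A x.

Section Purity.
Variables (R : pzRingType) (F : lmodType R).

Lemma equationally_flat_quotmod (K : submodule F) :
  equationally_flat F -> pure K -> equationally_flat (quotmod K).
Proof.
move=> flatF pureK m n A u; have [x ->] := to_quot_lift u => Ax.
have [i|k [Kk Ak]] := pureK _ _ A x.
  by rewrite -to_quot_eq0 linear_lincomb Ax.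
have -> : to_quot K \o x = to_quot K \o (x - k).
  by apply/funext => j; apply/eqP; rewrite to_quotE opprB addrC subrK.
by apply/trivial_relation_linear/flatF; rewrite raddfB /= Ak subrr.
Qed.

Lemma pure_preim_to_quot (K : submodule F) (L : submodule (quotmod K)) :
  pure K -> pure L -> pure (preim_submod (to_quot K) L).
Proof.
move=> pureK pureL m n A x Ax.
have [i|l] := pureL _ _ A (to_quot K \o x).
  by rewrite -linear_lincomb; apply: Ax.
have [y ->] := to_quot_lift l => -[Ly Ay].
have [i|k [Kk Ak]] := pureK _ _ A (x - y).
  by rewrite raddfB -to_quotE !linear_lincomb Ay.
exists (y + k); split=> [j|]; last by rewrite raddfD /= Ak raddfB addrC subrK.
have /eqP k0 : to_quot K (k j) == 0 by rewrite to_quot_eq0.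
by rewrite in_preim_submod linearD /= k0 addr0; apply: Ly.
Qed.

Lemma pure_zero : pure (zero_submod F).
Proof.
move=> m n A x Ax; exists 0; split=> [j|]; first by rewrite inE.
by rewrite raddf0; apply/funext => i; apply/esym/eqP/Ax.
Qed.

Section DirectedUnion.
Variables (I : Type) (i0 : I) (K : I -> submodule F).
Hypothesis directed : forall i j, exists k,
  {subset K i <= K k} /\ {subset K j <= K k}.

Definition directed_union_pred : {pred F} :=
  fun x => `[< exists i, x \in K i >].

Lemma directed_union_finite n (x : 'I_n -> F) :
  (forall j, x j \in directed_union_pred) -> exists i, forall j, x j \in K i.
Proof.
elim: n x => [|n IH] x Kx; first by exists i0 => -[].
have [i Ki] := IH (x \o fintype.lift ord0) (fun j => Kx _).
have /asboolP[i' Ki'] := Kx ord0; have [k [ik i'k]] := directed i i'.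
exists k => j; case: (unliftP ord0 j) => [j' ->|->]; first exact/ik/Ki.
exact: i'k.
Qed.

Lemma directed_union_closed : submod_closed directed_union_pred.
Proof.
split=> [|a x y /asboolP[i Kx] /asboolP[j Ky]]; apply/asboolP.
  by exists i0; apply: rpred0.
have [k [/(_ x Kx) kx /(_ y Ky) ky]] := directed i j.
by exists k; rewrite rpredD // rpredZ.
Qed.

Definition directed_union : submodule F := Submodule directed_union_closed.

Lemma pure_directed_union : (forall i, pure (K i)) -> pure directed_union.
Proof.
move=> pureK m n A x /directed_union_finite[i /pureK[k [Kk Ak]]].
by exists k; split=> // j; apply/asboolP; exists i.
Qed.

End DirectedUnion.

Lemma exists_maximal_submodule (P : submodule F -> Prop) :
  P (zero_submod F) ->
  (forall (I : Type) (i0 : I) (K : I -> submodule F) dirK,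
    (forall i, P (K i)) -> P (@directed_union I i0 K dirK)) ->
  exists K, P K /\ forall L, P L -> {subset K <= L} -> {subset L <= K}.
Proof.
move=> P0 Punion; pose T := {K : submodule F | P K}.
pose leT (K L : T) := `[< {subset sval K <= sval L} >].
have [K|K L M /asboolP KL /asboolP LM|C Ctot|[K PK] Kmax] :=
  @ZL_preorder T (exist _ _ P0) leT; first exact/asboolP.
- by apply/asboolP => x /KL /LM.
- have [[K0 CK0]|noC] := pselect (exists K, C K); last first.
    by exists (exist _ _ P0) => K CK; case: noC; exists K.
  pose member (K : {K : T | C K}) := sval (sval K).
  have dirC i j : exists k,
      {subset member i <= member k} /\ {subset member j <= member k}.
    have [/asboolP ij|/asboolP ji] := Ctot _ _ (svalP i) (svalP j).
      by exists j; split.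
    by exists i; split.
  have PC i : P (member i) := svalP (sval i).
  exists (exist _ _ (Punion _ (exist _ K0 CK0) _ dirC PC)) => K CK.
  by apply/asboolP => x Kx; apply/asboolP; exists (exist _ K CK).
exists K; split=> // L PL KL.
by have /asboolP := Kmax (exist _ L PL) (asboolT KL).
Qed.

End Purity.

Lemma exists_maximal_pure (R : pzRingType) (F N : lmodType R)
    (f : {linear F -> N}) :
  exists K : submodule F, (pure K /\ {subset K <= ker_submod f}) /\
    forall L : submodule F, pure L /\ {subset L <= ker_submod f} ->
      {subset K <= L} -> {subset L <= K}.
Proof.
apply: exists_maximal_submodule => [|I i0 K dirK PK].
  by split=> [|x /eqP ->]; [exact: pure_zero|rewrite in_ker_submod linear0].
split; first by apply: pure_directed_union => i; case: (PK i).
by move=> x /asboolP[i]; have [_] := PK i; apply.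
Qed.

Definition pure_reduced (R : pzRingType) (F N : lmodType R)
    (g : {linear F -> N}) : Prop :=
  forall L : submodule F, pure L -> {subset L <= ker_submod g} ->
    {subset L <= zero_submod F}.

Lemma exists_pure_reduced_quotmod (R : pzRingType) (F N : lmodType R)
    (f : {linear F -> N}) :
  exists (K : submodule F) (g : {linear quotmod K -> N}),
    [/\ pure K, forall x, g (to_quot K x) = f x & pure_reduced g].
Proof.
have [K [[pureK fK] Kmax]] := exists_maximal_pure f.
have [x /eqP|g gE] := @epi_factor _ _ _ _ _ f (@to_quot_epi _ _ K).
  by rewrite to_quot_eq0 => /fK /eqP.
exists K, g; split=> // L pureL gL u Lu.
rewrite in_zero_submod -[u]to_quotK to_quot_eq0.
apply: (Kmax (preim_submod (to_quot K) L)) => [|x Kx|].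
- split; first exact: pure_preim_to_quot.
  by move=> x /gL; rewrite !in_ker_submod gE.
- have /eqP x0 : to_quot K x == 0 by rewrite to_quot_eq0.
  by rewrite in_preim_submod /= x0 rpred0.
by rewrite in_preim_submod /= to_quotK.
Qed.

(** * Tensor products *)

Lemma freeg_ind_zmodClosed (X : choiceType) (S : zmodClosed {freeg X}) :
  (forall x, << x >> \in S) -> forall u, u \in S.
Proof.
move=> Sgen u; rewrite -[u]freeg_sumE; apply: rpred_sum => x _.
by rewrite -[coeff x u]intz -freegU_mulz rpredMz.
Qed.

Section TensorElements.
Variables (R : pzRingType) (A : lmodType R^c) (M : lmodType R).

HB.instance Definition _ := GRing.isZmodMorphism.Build _ _ (@to_tensor R A M)
  (@to_tensorB R A M).

Lemma to_tensor_eq0 u : to_tensor u = 0 :> tensor A M <-> tensor_rel u.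
Proof. by rewrite -(raddf0 (@to_tensor R A M)) to_tensor_eq subr0. Qed.

Lemma tensDl (x : M) : {morph (fun a : A => tens a x) : a b / a + b}.
Proof.
move=> a b; apply/eqP; rewrite -subr_eq0 opprD addrA /tens -!raddfB; apply/eqP.
exact/to_tensor_eq0/TensorRelDl.
Qed.

Lemma tensDr (a : A) : {morph (fun x : M => tens a x) : x y / x + y}.
Proof.
move=> x y; apply/eqP; rewrite -subr_eq0 opprD addrA /tens -!raddfB; apply/eqP.
exact/to_tensor_eq0/TensorRelDr.
Qed.

Lemma tensZ (a : A) (r : R) (x : M) : tens ((r : R^c) *: a) x = tens a (r *: x).
Proof. exact/to_tensor_eq/TensorRelZ. Qed.

Lemma tens0l (x : M) : tens (0 : A) x = 0.
Proof. by apply: (addrI (tens 0 x)); rewrite -tensDl !addr0. Qed.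

Lemma tens0r (a : A) : tens a (0 : M) = 0.
Proof. by apply: (addrI (tens a 0)); rewrite -tensDr !addr0. Qed.

Lemma tensNl (a : A) (x : M) : tens (- a) x = - tens a x.
Proof. by apply/eqP; rewrite -addr_eq0 -tensDl addNr tens0l. Qed.

Lemma tens_suml (I : Type) (r : seq I) (F : I -> A) (x : M) :
  tens (\sum_(i <- r) F i) x = \sum_(i <- r) tens (F i) x.
Proof. exact: (big_morph _ (tensDl x) (tens0l x)). Qed.

Lemma tens_sumr (I : Type) (r : seq I) (a : A) (F : I -> M) :
  tens a (\sum_(i <- r) F i) = \sum_(i <- r) tens a (F i).
Proof. exact: (big_morph _ (tensDr a) (tens0r a)). Qed.

Definition tens_sum (l : seq (A * M)) : tensor A M :=
  \sum_(z <- l) tens z.1 z.2.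

Definition tens_sum_pred : {pred {freeg (A * M)%type}} :=
  fun u => `[< exists l, to_tensor u = tens_sum l >].

Lemma tens_sum_pred_zmod_closed : zmod_closed tens_sum_pred.
Proof.
split=> [|u v /asboolP[l ul] /asboolP[k vk]]; apply/asboolP.
  by exists [::]; rewrite raddf0 /tens_sum big_nil.
exists (l ++ [seq (- z.1, z.2) | z <- k]).
rewrite raddfB /= ul vk /tens_sum big_cat big_map -sumrN; congr (_ + _).
by apply: eq_bigr => z _; rewrite tensNl.
Qed.

HB.instance Definition _ :=
  GRing.isZmodClosed.Build {freeg (A * M)%type} tens_sum_pred
    tens_sum_pred_zmod_closed.

Lemma tensor_tens_sum (t : tensor A M) : exists l, t = tens_sum l.
Proof.
have <- : to_tensor (repr t) = t by rewrite /to_tensor reprK.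
apply/asboolP/(@freeg_ind_zmodClosed _ tens_sum_pred) => -[a x].
by apply/asboolP; exists [:: (a, x)]; rewrite /tens_sum big_seq1.
Qed.

Record balanced_mod (G : zmodType) (S : zmodClosed G)
    (phi : A -> M -> G) : Prop := BalancedMod {
  balanced_modDl a b x : phi (a + b) x - phi a x - phi b x \in S;
  balanced_modDr a x y : phi a (x + y) - phi a x - phi a y \in S;
  balanced_modZ a (r : R) x : phi ((r : R^c) *: a) x - phi a (r *: x) \in S
}.

Lemma balanced_mod_tens_sum0 (G : zmodType) (S : zmodClosed G)
    (phi : A -> M -> G) (l : seq (A * M)) :
  balanced_mod S phi -> tens_sum l = 0 -> \sum_(z <- l) phi z.1 z.2 \in S.
Proof.
move=> [phiDl phiDr phiZ].
pose Phi : {additive {freeg (A * M)%type} -> zmodule G} :=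
  HB.pack (fglift (fun z => phi z.1 z.2 : zmodule G))
    (GRing.isZmodMorphism.Build _ _ _ (lift_is_additive _)).
have PhiU a x : Phi << (a, x) >> = phi a x by rewrite /= liftU scale1r.
have PhiS u : tensor_rel u -> (Phi u : G) \in S.
  elim=> [|v w _ vS _ wS|a b x|a x y|a r x].
  - by rewrite raddf0 rpred0.
  - by rewrite raddfB rpredB.
  - by rewrite !raddfB !PhiU; apply: phiDl.
  - by rewrite !raddfB !PhiU; apply: phiDr.
  - by rewrite !raddfB !PhiU; apply: phiZ.
have -> : tens_sum l = to_tensor (\sum_(z <- l) << z >>).
  by rewrite raddf_sum; apply: eq_bigr => -[].
have <- : Phi (\sum_(z <- l) << z >>) = \sum_(z <- l) phi z.1 z.2 :> G.
  by rewrite raddf_sum; apply: eq_bigr => -[a x] _; apply: PhiU.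
by move/to_tensor_eq0/PhiS.
Qed.

End TensorElements.

HB.instance Definition _ (R : pzRingType) (A B : lmodType R^c) (M : lmodType R)
    (f : {linear A -> B}) :=
  GRing.isZmodMorphism.Build (tensor A M) (tensor B M) (@tensor_map R A B M f)
    (@tensor_mapB R A B M f).

Lemma tensor_map_tens_sum (R : pzRingType) (A B : lmodType R^c)
    (M : lmodType R) (f : {linear A -> B}) (l : seq (A * M)) :
  tensor_map f (tens_sum l) = tens_sum [seq (f z.1, z.2) | z <- l].
Proof.
rewrite raddf_sum /tens_sum big_map; apply: eq_bigr => z _.
exact: tensor_map_tens.
Qed.

(** * Flatness is equational *)

Definition satisfies (R : pzRingType) (M N : lmodType R)
    (T : seq (freemod R M)) (c : M -> N) : Prop :=
  {in T, forall r, free_ext c r = 0}.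

Section VanishingTensors.
Variables (R : pzRingType) (B : lmodType R^c) (M : lmodType R).

(* Reading b (x) x as the function c |-> c x *: b, these functions stand for  *)
(* the image of B (x) ker (free M -> M) in B (x) free M.                      *)
Definition zero_modulo_relations : {pred (M -> R^o) -> B} :=
  fun g => `[< exists T : seq (freemod R M),
    satisfies T (id : M -> M) /\ forall c, satisfies T c -> g c = 0 >].

Lemma zero_modulo_relations_zmod_closed : zmod_closed zero_modulo_relations.
Proof.
split=> [|g h /asboolP[T [T0 gT]] /asboolP[U [U0 hU]]]; apply/asboolP.
  by exists [::].
exists (T ++ U); split=> [r|c TU0]; first by rewrite mem_cat => /orP[/T0|/U0].
rewrite !fctE gT ?hU ?subrr // => r rTU; apply: TU0.
  by rewrite mem_cat rTU orbT.
by rewrite mem_cat rTU.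
Qed.

HB.instance Definition _ := GRing.isZmodClosed.Build ((M -> R^o) -> B)
  zero_modulo_relations zero_modulo_relations_zmod_closed.

Lemma balanced_zero_modulo_relations :
  balanced_mod zero_modulo_relations
    (fun (b : B) (x : M) (c : M -> R^o) => (c x : R^c) *: b).
Proof.
split=> [a b x|b x y|b r x]; apply/asboolP.
- by exists [::]; split=> // c _; rewrite !fctE /= scalerDr addrAC addrK subrr.
- exists [:: free_gen (x + y) - free_gen x - free_gen y]; split=> [w|c].
    rewrite inE => /eqP ->; rewrite !linearB !free_ext_gen.
    by rewrite addrAC addrK subrr.
  move=> /(_ _ (mem_head _ _)); rewrite !linearB !free_ext_gen => cxy.
  by rewrite !fctE /= -!scalerBl cxy scale0r.
exists [:: r *: free_gen x - free_gen (r *: x)]; split=> [w|c].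
  by rewrite inE => /eqP ->; rewrite linearB linearZ !free_ext_gen subrr.
move=> /(_ _ (mem_head _ _)); rewrite linearB linearZ !free_ext_gen => crx.
by rewrite !fctE /= scalerA -scalerBl [X in X *: b]crx scale0r.
Qed.

Lemma tens_sum_eq0_relations (l : seq (B * M)) : tens_sum l = 0 ->
  exists T : seq (freemod R M), satisfies T (id : M -> M) /\
    forall c : M -> R^o, satisfies T c ->
      \sum_(z <- l) (c z.2 : R^c) *: z.1 = 0.
Proof.
move=> /(balanced_mod_tens_sum0 balanced_zero_modulo_relations)/asboolP.
by move=> [T [T0 Tl]]; exists T; split=> // c /Tl; rewrite fct_sumE.
Qed.

End VanishingTensors.

Section FlatEquational.
Variables (R : pzRingType) (M : lmodType R).

Lemma equationally_flat_free_relations (T : seq (freemod R M)) (s : seq M) :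
  equationally_flat M -> satisfies T (id : M -> M) ->
  exists k (c : 'I_k -> M -> R^o) (y : 'I_k -> M),
    (forall i, satisfies T (c i)) /\
    {in s, forall x, x = \sum_(i < k) (c i x : R) *: y i}.
Proof.
move=> flatM T0; pose S := undup (s ++ common_supp T).
have supp_S r x : r \in T -> x \notin S -> coef x r = 0.
  move=> rT; rewrite mem_undup mem_cat => /norP[_].
  exact: component_common_supp.
pose t := tnth (in_tuple S).
have free_ext_S r (N : lmodType R) (g : M -> N) : r \in T ->
    free_ext g r = \sum_j (coef (t j) r : R) *: g (t j).
  move=> rT; rewrite (free_extE g (undup_uniq _) (fun x => supp_S r x rT)).
  exact: big_tnth.
pose A : 'M[R]_(size T, size S) :=
  \matrix_(i, j) coef (t j) (tnth (in_tuple T) i).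
have /asboolP[k [D [y [AD tD]]]] : t \in trivial_relation A.
  apply/flatM/funext => i; have rT := mem_tnth i (in_tuple T).
  by rewrite -[RHS](T0 _ rT) free_ext_S //; apply: eq_bigr => j _; rewrite mxE.
pose c i x : R^o := \sum_(j | t j == x) D j i.
have cE i j : c i (t j) = D j i.
  apply: big_pred1 => j'; apply: inj_eq; apply/tuple_uniqP; exact: undup_uniq.
exists k, c, y; split=> [i r rT|x xs].
  have [i' rE] := seq_tnthP rT.
  have /matrixP/(_ i' i) := AD; rewrite !mxE => AD0.
  by rewrite free_ext_S // -[RHS]AD0; apply: eq_bigr => j _; rewrite cE mxE rE.
have /seq_tnthP[j ->] : x \in S by rewrite mem_undup mem_cat xs.
by rewrite [LHS](congr1 (@^~ j) tD); apply: eq_bigr => i _; rewrite cE.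
Qed.

Lemma equationally_flat_flat : equationally_flat M -> flat M.
Proof.
move=> flatM A B f f_inj; apply: raddf_inj => u.
have [l ->] := tensor_tens_sum u; rewrite /= tensor_map_tens_sum.
move=> /tens_sum_eq0_relations[T [T0 cT]].
have [k [c [y [c0 lE]]]] :=
  equationally_flat_free_relations (unzip2 l) flatM T0.
have ca0 i : \sum_(z <- l) (c i z.2 : R^c) *: z.1 = 0.
  apply: f_inj; rewrite linear0 linear_sum -[RHS](cT (c i) (c0 i)) big_map.
  by apply: eq_bigr => z _; rewrite linearZ.
transitivity (\sum_(z <- l) \sum_(i < k) tens ((c i z.2 : R^c) *: z.1) (y i)).
  apply: eq_big_seq => z zl; rewrite [in LHS](lE z.2) ?map_f // tens_sumr.
  by apply: eq_bigr => i _; rewrite tensZ.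
rewrite exchange_big big1 // => i _.
by rewrite -tens_suml ca0 tens0l.
Qed.

End FlatEquational.

Section ColumnModule.
Variables (R : pzRingType) (M : lmodType R) (m n : nat) (A : 'M[R]_(m, n)).

(* The action of A on columns, rendered with rows over R^c. *)
Definition col_action : {linear 'rV[R^c]_n -> 'rV[R^c]_m} :=
  mulmxr (\matrix_(j, i) A i j : 'M[R^c]_(n, m)).

Local Notation K := (ker_submod col_action).
Local Notation e j := (delta_mx 0 j : 'rV[R^c]_n).

Lemma col_action_delta j :
  col_action (e j) = \sum_(i < m) (A i j : R^c) *: delta_mx 0 i.
Proof.
rewrite /= -rowE [LHS]row_sum_delta.
by apply: eq_bigr => i _; rewrite !mxE.
Qed.

Lemma ker_col_action_trivial (v : 'rV[R^c]_n) (y : M) :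
  v \in K -> (fun j => (v 0 j : R) *: y) \in trivial_relation A.
Proof.
rewrite in_ker_submod => /eqP v0.
pose d : 'cV[R]_n := \col_j v 0 j.
have -> : (fun j => (v 0 j : R) *: y) = fun j => d j 0 *: y.
  by apply/funext => j; rewrite mxE.
apply: trivial_relation_col; apply/matrixP=> i j.
have /matrixP/(_ 0 i) := v0; rewrite !mxE => vi0; rewrite -[RHS]vi0.
by apply: eq_bigr => k _; rewrite !mxE.
Qed.

Lemma balanced_trivial_relation : balanced_mod (@trivial_relation R M m n A)
  (fun (u : quotmod K) (y : M) j => (repr u 0 j : R) *: y).
Proof.
split=> [u v y|u y z|u r y].
- pose w := repr (u + v) - repr u - repr v.
  rewrite (_ : _ - _ = fun j => (w 0 j : R) *: y).
    apply: ker_col_action_trivial; rewrite -to_quot_eq0 !linearB /= !to_quotK.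
    by rewrite addrAC addrK subrr.
  by apply/funext => j; rewrite !fctE /= -!scalerBl !mxE.
- rewrite (_ : _ - _ = 0) ?rpred0 //.
  by apply/funext => j; rewrite !fctE /= scalerDr addrAC addrK subrr.
pose w := repr ((r : R^c) *: u) - (r : R^c) *: repr u.
rewrite (_ : _ - _ = fun j => (w 0 j : R) *: y).
  by apply: ker_col_action_trivial; rewrite -to_quotE linearZ /= !to_quotK.
by apply/funext => j; rewrite !fctE /= scalerA -scalerBl !mxE.
Qed.

(* Flatness makes I (x) M -> R^m (x) M injective, for I the image of A. *)
Lemma flat_tens_sum_delta (x : 'I_n -> M) : flat M -> lincomb A x = 0 ->
  \sum_(j < n) tens (to_quot K (e j)) (x j) = 0.
Proof.
move=> flatM Ax; have [g [g_inj gE]] := quotmod_ker_embedding col_action.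
apply: (flatM _ _ _ g_inj); rewrite raddf0 raddf_sum /=.
under eq_bigr => j _ do rewrite tensor_map_tens gE col_action_delta tens_suml.
rewrite exchange_big big1 // => i _.
under eq_bigr => j _ do rewrite tensZ.
by rewrite -tens_sumr -[\sum_j _]/(lincomb A x i) Ax tens0r.
Qed.

Lemma tens_sum_delta_trivial (x : 'I_n -> M) :
  \sum_(j < n) tens (to_quot K (e j)) (x j) = 0 -> x \in trivial_relation A.
Proof.
pose l := [seq (to_quot K (e j), x j) | j <- index_enum 'I_n].
have -> : \sum_(j < n) tens (to_quot K (e j)) (x j) = tens_sum l.
  by rewrite /tens_sum big_map.
move/(balanced_mod_tens_sum0 balanced_trivial_relation).
rewrite big_map /= => xl.
pose d j := e j - repr (to_quot K (e j)).
have dK j : d j \in K by rewrite -to_quotE to_quotK.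
have -> : x = \sum_k (fun j => (d k 0 j : R) *: x k) +
              \sum_k (fun j => (repr (to_quot K (e k)) 0 j : R) *: x k).
  rewrite -big_split /=; apply/funext => j.
  rewrite fct_sumE (bigD1 j) //= big1 ?addr0 => [|k kj].
    by rewrite !fctE /= -scalerDl !mxE subrK !eqxx scale1r.
  by rewrite !fctE /= -scalerDl !mxE subrK eq_sym (negbTE kj) andbF scale0r.
by rewrite rpredD // rpred_sum // => k _; apply: ker_col_action_trivial.
Qed.

End ColumnModule.

Lemma flat_equationally_flat (R : pzRingType) (M : lmodType R) :
  flat M -> equationally_flat M.
Proof.
by move=> flatM m n A x Ax; apply/tens_sum_delta_trivial/flat_tens_sum_delta.
Qed.

(** * Existence of flat precovers *)

Section DifferenceSection.
Variables (G H : zmodType) (f : {additive G -> H}).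

Definition additive_image : {pred H} := fun y => `[< exists x, f x = y >].

Lemma additive_image_zmod_closed : zmod_closed additive_image.
Proof.
split=> [|_ _ /asboolP[x <-] /asboolP[y <-]]; apply/asboolP.
  by exists 0; rewrite raddf0.
by exists (x - y); rewrite raddfB.
Qed.

HB.instance Definition _ :=
  GRing.isZmodClosed.Build H additive_image additive_image_zmod_closed.

(* s c is a preimage of the difference of c and the representative of its     *)
(* coset modulo the image of f.                                               *)
Lemma exists_difference_section :
  exists s : H -> G,
    forall c d, (exists x, f x = c - d) -> f (s c - s d) = c - d.
Proof.
pose Q := Quotient.quot additive_image.
pose r c : H := repr (\pi_Q c).
have /choice[s fs] c : exists x, f x = c - r c.
  have /asboolP : c - r c \in additive_image by rewrite Quotient.idealrBE reprK.
  exact.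
exists s => c d cd; rewrite raddfB /= !fs.
have -> : r c = r d; last by rewrite opprB addrA subrK.
by congr repr; apply/eqP; rewrite -Quotient.idealrBE; apply/asboolP.
Qed.

End DifferenceSection.

Inductive term (R : pzRingType) :=
  | TermVar
  | TermComb (a : R) (t u : term R)
  | TermSolution m n (A : 'M[R]_(m, n)) (ts : 'I_m -> term R) (j : 'I_n).
Arguments TermVar {R}.

Section TermEvaluation.
Variables (R : pzRingType) (F : lmodType R).

Definition solution m n (A : 'M[R]_(m, n)) : ('I_m -> F) -> 'I_n -> F :=
  sval (cid (exists_difference_section (@lincomb R F m n A))).

Lemma solutionB m n (A : 'M[R]_(m, n)) (c d : 'I_m -> F) :
  (exists x, lincomb A x = c - d) ->
  lincomb A (solution A c - solution A d) = c - d.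
Proof. exact: svalP (cid (exists_difference_section _)) c d. Qed.

Fixpoint eval (t : term R) : F -> F :=
  match t with
  | TermVar => id
  | TermComb a t u => fun x => a *: eval t x + eval u x
  | TermSolution m n A ts j => fun x => solution A (fun i => eval (ts i) x) j
  end.

Section TermDifferences.
Variables x y : F.

Definition term_difference : {pred F} :=
  fun z => `[< exists t, z = eval t x - eval t y >].

Lemma term_difference_closed : submod_closed term_difference.
Proof.
split=> [|a _ _ /asboolP[t ->] /asboolP[u ->]]; apply/asboolP.
  by exists (TermComb (-1) TermVar TermVar); rewrite /= !scaleN1r !addNr subrr.
by exists (TermComb a t u); rewrite /= opprD addrACA scalerBr.
Qed.

Definition term_difference_submod : submodule F :=
  Submodule term_difference_closed.

Lemma pure_term_difference : pure term_difference_submod.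
Proof.
move=> m n A z Az.
have /choice[ts tsE] i : exists t, lincomb A z i = eval t x - eval t y.
  exact/asboolP/Az.
pose w j := eval (TermSolution A ts j) x - eval (TermSolution A ts j) y.
exists w; split=> [j|]; first by apply/asboolP; exists (TermSolution A ts j).
have -> : lincomb A z = (fun i => eval (ts i) x) - (fun i => eval (ts i) y).
  exact/funext.
by apply: solutionB; exists z; apply/funext.
Qed.

End TermDifferences.

Lemma eval_injective (N : lmodType R) (g : {linear F -> N}) :
  pure_reduced g -> injective (fun x t => g (eval t x)).
Proof.
move=> g_reduced x y gxy; apply/eqP; rewrite -subr_eq0 -in_zero_submod.
apply: (g_reduced _ (@pure_term_difference x y)) => [z /asboolP[t ->]|].
  by rewrite in_ker_submod linearB subr_eq0 (congr1 (@^~ t) gxy).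
by apply/asboolP; exists TermVar.
Qed.

End TermEvaluation.

Lemma flat_factor_small (R : pzRingType) (F N : lmodType R)
    (f : {linear F -> N}) : flat F ->
  exists (Q : lmodType R) (p : {linear F -> Q}) (g : {linear Q -> N})
         (c : Q -> term R -> N),
    [/\ equationally_flat Q, injective c & forall x, g (p x) = f x].
Proof.
move=> /flat_equationally_flat flatF.
have [K [g [pureK gE g_reduced]]] := exists_pure_reduced_quotmod f.
exists (quotmod K), (to_quot K), g, (fun u t => g (eval t u)); split=> //.
  exact: equationally_flat_quotmod.
exact: eval_injective.
Qed.

Section FlatPrecover.
Variables (R : pzRingType) (N : lmodType R).

Let X : choiceType := (term R -> N)%type.

(* Flat modules over N that embed into X, coded as quotients of the free      *)
(* module on X so that they form a set.                                       *)
Record small_flat := SmallFlat {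
  small_flat_ker : submodule (freemod R X);
  small_flat_map : {linear quotmod small_flat_ker -> N};
  small_flatP : equationally_flat (quotmod small_flat_ker)
}.

Let I : choiceType := {classic small_flat}.

Definition small_flat_sum : lmodType R :=
  dsum (fun i : I => quotmod (small_flat_ker i)).

Definition small_flat_sum_map : {linear small_flat_sum -> N} :=
  dsum_ext (fun i : I => small_flat_map i).

Lemma small_flat_code (Q : lmodType R) (c : Q -> X) (q : {linear Q -> N}) :
  injective c -> equationally_flat Q ->
  exists (i : I) (s : {linear Q -> quotmod (small_flat_ker i)}),
    forall u, small_flat_map i (s u) = q u.
Proof.
move=> c_inj flatQ.
pose d t : Q := xget 0 [set u | c u = t]%classic.
have cK u : d (c u) = u.
  by apply: c_inj; apply: (@xgetPex _ 0 [set v | c v = c u]%classic); exists u.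
have d_epi : epi (free_ext d).
  by move=> u; exists (free_gen (c u)); rewrite free_ext_gen cK.
have [r [r_bij _]] := quotmod_ker_iso d_epi.
have [s [rK sK]] := bij_linear_inverse r_bij.
have flat_ker := equationally_flat_retract rK flatQ.
by exists (SmallFlat (q \o r) flat_ker), s => u /=; rewrite sK.
Qed.

Theorem exists_flat_precover :
  exists (F : lmodType R) (g : {linear F -> N}), flat_precover g.
Proof.
exists small_flat_sum, small_flat_sum_map; split=> [|F flatF f].
  apply/equationally_flat_flat/equationally_flat_dsum => i.
  exact: small_flatP.
have [Q [p [g [c [flatQ c_inj gp]]]]] := flat_factor_small f flatF.
have [i [s gs]] := small_flat_code g c_inj flatQ.
exists (@inject R I _ i \o s \o p) => x /=.
by rewrite /small_flat_sum_map /= dsum_ext_inject gs gp.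
Qed.

End FlatPrecover.

(** * Factorizations through free modules *)

Section Factorization.
Variable R : pzRingType.
Implicit Types B F M N P : lmodType R.

Lemma row_ext_linear M n (e : 'I_n -> M) :
  linear (fun w : 'rV[R]_n => lincomb w e 0).
Proof. by move=> a v w; rewrite lincomb_linearl. Qed.

Definition row_ext M n (e : 'I_n -> M) : {linear 'rV[R]_n -> M} :=
  linear_pack (row_ext_linear e).

Lemma row_linearE M n (f : {linear 'rV[R]_n -> M}) w :
  f w = lincomb w (fun i => f (delta_mx 0 i)) 0.
Proof.
rewrite [w in LHS]row_sum_delta linear_sum; apply: eq_bigr => i _.
by rewrite linearZ.
Qed.

Lemma hom_factors_through (Q : lmodType R -> Prop) N :
  (forall (S : pred N) (C : subLmodType S), finitely_generated C ->
    exists P, Q P /\ factors_through P (\val : {linear C -> N})) ->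
  forall M (f : {linear M -> N}), finitely_generated M ->
    exists P, Q P /\ factors_through P f.
Proof.
move=> subQ M f [n [e eM]].
have [|P [QP [u [v uv]]]] := subQ _ (submod_type (image_submod f)).
  exists n, (to_image f \o e) => y; have [x <-] := to_image_epi y.
  have [c ->] := eM x; exists c; rewrite linear_sum.
  by apply: eq_bigr => i _; rewrite linearZ.
by exists P; split=> //; exists (u \o to_image f), v => x; rewrite /= uv.
Qed.

Lemma fg_free_row n : fg_free 'rV[R]_n.
Proof. by exists n, idfun; exists id. Qed.

Lemma fg_free_finitely_presented P : fg_free P -> finitely_presented P.
Proof.
move=> [n [f f_bij]]; exists 0%N, n, \0, f; split=> [y|v].
  by have [g _ fK] := f_bij; exists (g y).
split=> [fv|[w <-]]; last exact: linear0.
by exists 0; apply: (bij_inj f_bij); rewrite fv [LHS]linear0.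
Qed.

Lemma fg_free_lift P B N (g : {linear B -> N}) (v : {linear P -> N}) :
  fg_free P -> epi g -> exists h : {linear P -> B}, forall x, g (h x) = v x.
Proof.
move=> [n [f /bij_linear_inverse[f' [_ f'K]]]] /choice[s sK].
exists (row_ext (fun i => s (v (f (delta_mx 0 i)))) \o f') => x /=.
rewrite linear_lincomb -[x in RHS]f'K -[RHS]/((v \o f) (f' x)) row_linearE.
by congr (lincomb _ _ _); apply/funext => i; rewrite /= sK.
Qed.

Lemma flat_finitely_presented_factor P M (v : {linear P -> M}) :
  flat M -> finitely_presented P ->
  exists Q : lmodType R, fg_free Q /\ factors_through Q v.
Proof.
move=> /flat_equationally_flat flatM [m [n [q [p [p_epi pq]]]]].
pose A : 'M[R]_(m, n) := \matrix_(i, j) q (delta_mx 0 i) 0 j.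
have qE w : q w = w *m A.
  rewrite row_linearE; apply/rowP=> j; rewrite summxE mxE.
  by apply: eq_bigr => i _; rewrite !mxE.
pose x j := v (p (delta_mx 0 j)).
have vpE w : v (p w) = lincomb w x 0 := row_linearE (v \o p) w.
have /asboolP[k [D [y [AD xD]]]] : x \in trivial_relation A.
  apply/flatM/funext => i.
  have /pq qi0 : exists w, q w = q (delta_mx 0 i) by exists (delta_mx 0 i).
  rewrite -[RHS](linear0 v) -[in RHS]qi0 vpE.
  by apply: eq_bigr => j _; rewrite mxE.
have [w /pq[z <-]|u uE] := @epi_factor _ _ _ _ p (mulmxr D) p_epi.
  by rewrite qE /= -mulmxA AD mulmx0.
exists 'rV[R]_k; split; first exact: fg_free_row.
exists u, (row_ext y) => z /=; have [w <-] := p_epi z.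
by rewrite uE vpE xD -lincombM.
Qed.

Lemma flat_mittag_leffler_f_projective M :
  flat M -> mittag_leffler M -> f_projective M.
Proof.
move=> flatM mlM S C /mlM[P [fpP [u [v uv]]]].
have [Q [freeQ [u' [v' u'v']]]] := flat_finitely_presented_factor v flatM fpP.
by exists Q; split=> //; exists (u' \o u), v' => x; rewrite /= u'v' uv.
Qed.

Lemma flat_precover_epi F N (g : {linear F -> N}) : flat_precover g -> epi g.
Proof.
move=> [_ g_cover] y.
have flatR := equationally_flat_flat (@equationally_flat_regular R).
have [h gh] := g_cover _ flatR (scaler_to y).
by exists (h 1); rewrite gh /= scale1r.
Qed.

Lemma finitely_generated_free_factor M (X : choiceType) N
    (h : {linear M -> freemod R X}) (g : X -> N) :
  finitely_generated M ->
  exists P, fg_free P /\ factors_through P (free_ext g \o h).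
Proof.
move=> [n [e eM]].
pose s := common_supp (codom (h \o e)).
have hs x y : y \notin s -> coef y (h x) = 0.
  move=> ys; have [c ->] := eM x; rewrite !linear_sum big1 // => i _.
  rewrite !linearZ /= (component_common_supp _ ys) ?scaler0 //.
  exact: (codom_f (h \o e)).
pose t := tnth (in_tuple s).
have u_lin : linear (fun x => \row_(j < size s) (coef (t j) (h x) : R)).
  by move=> a x y; apply/rowP=> j; rewrite !mxE !linearP.
exists 'rV[R]_(size s); split; first exact: fg_free_row.
exists (linear_pack u_lin), (row_ext (g \o t)) => x /=.
rewrite [RHS](free_extE g (common_supp_uniq _) (hs x)) big_tnth.
by apply: eq_bigr => j _; rewrite mxE.
Qed.

Lemma f_projective_subprojectivity N :
  f_projective N <->
  (forall M, finitely_generated M -> subprojectivity_domain M N).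
Proof.
split=> [projN M fgM B g f g_epi|N_sub S C fgC].
  have [P [freeP [u [v uv]]]] := hom_factors_through projN f fgM.
  have [h gh] := fg_free_lift v freeP g_epi.
  by exists (h \o u) => x; rewrite /= gh uv.
have [y|h gh] := N_sub C fgC _ (free_ext (id : N -> N)) \val.
  by exists (free_gen y); apply: free_ext_gen.
have [P [freeP [u [v uv]]]] := finitely_generated_free_factor h id fgC.
by exists P; split=> //; exists u, v => x; rewrite uv /= gh.
Qed.

Lemma subprojectivity_flat_precover_completing M N :
  subprojectivity_domain M N -> flat_precover_completing_domain M N.
Proof. by move=> MN f F g /flat_precover_epi; apply: MN. Qed.

Lemma flat_precover_completing_subprojectivity M N :
  (forall F, flat F -> f_projective F) -> finitely_generated M ->
  flat_precover_completing_domain M N -> subprojectivity_domain M N.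
Proof.
move=> flat_proj fgM MN B g f g_epi.
have [F [p p_cover]] := exists_flat_precover N.
have [h ph] := MN f F p p_cover; have [/flat_proj projF _] := p_cover.
have [P [freeP [u [v uv]]]] := hom_factors_through projF h fgM.
have [k gk] := fg_free_lift (p \o v) freeP g_epi.
by exists (k \o u) => x; rewrite /= gk /= uv ph.
Qed.

Lemma flat_precover_completing_flat M F :
  flat F -> flat_precover_completing_domain M F.
Proof.
move=> flatF f G g [_ g_cover]; have [h gh] := g_cover F flatF idfun.
by exists (h \o f) => x; rewrite /= gh.
Qed.

End Factorization.

Theorem proposition3p7 (R : pzRingType) :
  [<-> (forall M : lmodType R, flat M -> f_projective M);
       (forall M : lmodType R, flat M -> mittag_leffler M);
       (forall M : lmodType R, finitely_generated M ->
          forall N : lmodType R,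
            flat_precover_completing_domain M N <-> subprojectivity_domain M N);
       (forall N : lmodType R,
          (forall M : lmodType R, finitely_generated M ->
             flat_precover_completing_domain M N) <-> f_projective N)].
Proof.
tfae.
- move=> proj M flatM S C /(proj M flatM)[P [freeP factor]].
  by exists P; split=> //; apply: fg_free_finitely_presented.
- move=> ml M fgM N.
  split; last exact: subprojectivity_flat_precover_completing.
  apply: flat_precover_completing_subprojectivity => // F flatF.
  exact: flat_mittag_leffler_f_projective (ml F flatF).
- move=> dom N; rewrite f_projective_subprojectivity.
  by split=> MN M fgM; apply/dom => //; apply: MN.
- by move=> dom F flatF; apply/dom => M _; apply: flat_precover_completing_flat.
Qed.
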